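(* Let $\bm{A}$ be an $n\times n$ matrix over $\mathbb{R}_{\max,\times}$ (that is, with nonnegative real entries) such that the matrix $\bm{B}=\bm{A}\oplus\bm{A}^{-}$ has no zero entries. Let $\mu$ be the spectral radius of $\bm{B}$, and let $\bm{B}_{\mu}=\mu^{-1}\bm{B}$. Consider the problem of minimizing $\rho(\bm{A},\bm{x}\bm{x}^{-})$ over all regular column vectors $\bm{x}$ with $n$ entries (that is, over all $\bm{x}\in\mathbb{R}_{+}^{n}$). Then the minimum value in this problem is equal to $\mu$, and all solutions (the regular vectors attaining the minimum) are given by $$\bm{x}=\bm{B}_{\mu}^{\ast}\bm{u},\qquad \bm{u}\in\mathbb{R}_{+}^{n}.$$
   Context: Semifield: $\mathbb{R}_{+}=\{x\in\mathbb{R}\mid x>0\}$, and $\mathbb{R}_{\max,\times}=(\mathbb{R}_{+}\cup\{0\},\max,\times,0,1)$ is the idempotent semifield of nonnegative reals in which addition is $x\oplus y=\max(x,y)$, multiplication is the usual multiplication, the zero is $0$ and the unit is $1$; inverses, powers (including rational exponents) and the order are the usual ones. Vectors and matrices: all vector and matrix sums and products are computed with $\oplus=\max$ in place of $+$ and with the usual multiplication; e.g. $(\bm{A}\oplus\bm{B})_{ij}=\max(a_{ij},b_{ij})$, $(\bm{A}\bm{B})_{ij}=\max_k a_{ik}b_{kj}$. A vector is regular if it has no zero entries. For a column vector $\bm{x}=(x_i)$, $\bm{x}^{-}$ is the row vector with entries $x_i^{-1}$ if $x_i\neq 0$ and $0$ otherwise; so for regular $\bm{x}$, $\bm{x}\bm{x}^{-}$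 is the $n\times n$ matrix with entries $x_i/x_j$. For a matrix $\bm{A}=(a_{ij})$, $\bm{A}^{-}$ is the matrix whose $(i,j)$ entry is $a_{ji}^{-1}$ if $a_{ji}\neq 0$ and $0$ otherwise. $\bm{I}$ is the identity matrix ($1$ on the diagonal and $0$ elsewhere), $\bm{A}^{0}=\bm{I}$, $\bm{A}^{p}=\bm{A}^{p-1}\bm{A}$. The trace is $\mathrm{tr}\,\bm{A}=a_{11}\oplus\cdots\oplus a_{nn}=\max_i a_{ii}$. Approximation error (Chebyshev-like distance): $\rho(\bm{A},\bm{B})=\mathrm{tr}(\bm{B}^{-}\bm{A})\oplus\mathrm{tr}(\bm{A}^{-}\bm{B})$. Spectral radius: the spectral radius of an $n\times n$ matrix $\bm{A}=(a_{ij})$ is its maximum eigenvalue in the max-times sense (a scalar $\lambda$ with $\bm{A}\bm{x}=\lambda\bm{x}$ for some nonzero vector $\bm{x}$), calculated as $\lambda=\bigoplus_{k=1}^{n}\mathrm{tr}^{1/k}(\bm{A}^{k})=\max_{1\le k\le n}\ \max_{1\le i_1,\ldots,i_k\le n}(a_{i_1i_2}a_{i_2i_3}\cdots a_{i_ki_1})^{1/k}$. Kleene star: for an $n\times n$ matrix $\bm{A}$ with $\mathrm{tr}\,\bm{A}\oplus\cdots\oplus\mathrm{tr}\,\bm{A}^{n}\le 1$, $\bm{A}^{\ast}=\bm{I}\oplus\bm{A}\oplus\cdots\oplus\bm{A}^{n-1}$. *)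

(* Defs.v *)
From HB Require Import structures.
From mathcomp Require Import all_boot all_order all_algebra.
From mathcomp Require Import reals exp.

Set Implicit Arguments.
Unset Strict Implicit.
Unset Printing Implicit Defensive.

Import Order.TTheory GRing.Theory Num.Theory.
Local Open Scope ring_scope.

(* The idempotent semifield R_(max,x).  Its structure of commutative semiring
   makes every library operation on scalars, vectors and matrices over it
   (x + y, \sum, A + B, A *m B, a *: A, A ^+ k, 1%:M, \tr A) the max-times
   one: "+" and "\sum" are maxima and "*" is the usual product. *)
Record maxtimes (R : realType) := MaxTimes { mtval : R; _ : 0 <= mtval }.

Section MaxTimesStructure.
Variable R : realType.
Implicit Types x y z : maxtimes R.

HB.instance Definition _ := [isSub for @mtval R].
HB.instance Definition _ := [Choice of maxtimes R by <:].
HB.instance Definition _ :=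
  [SubChoice_isSubOrder of maxtimes R by <: with ring_display].

Lemma mtval_ge0 x : 0 <= mtval x. Proof. exact: valP x. Qed.

Lemma mt_add_subproof x y : 0 <= Num.max (mtval x) (mtval y).
Proof. by rewrite le_max mtval_ge0. Qed.

Definition mt_zero : maxtimes R := MaxTimes (lexx 0).
Definition mt_one : maxtimes R := MaxTimes ler01.
Definition mt_add x y : maxtimes R := MaxTimes (mt_add_subproof x y).
Definition mt_mul x y : maxtimes R :=
  MaxTimes (mulr_ge0 (mtval_ge0 x) (mtval_ge0 y)).

Lemma mt_addA : associative mt_add.
Proof. by move=> x y z; apply/val_inj; rewrite /= maxA. Qed.
Lemma mt_addC : commutative mt_add.
Proof. by move=> x y; apply/val_inj; rewrite /= maxC. Qed.
Lemma mt_add0 : left_id mt_zero mt_add.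
Proof. by move=> x; apply/val_inj/max_r/mtval_ge0. Qed.
Lemma mt_mulA : associative mt_mul.
Proof. by move=> x y z; apply/val_inj; rewrite /= mulrA. Qed.
Lemma mt_mulC : commutative mt_mul.
Proof. by move=> x y; apply/val_inj; rewrite /= mulrC. Qed.
Lemma mt_mul1 : left_id mt_one mt_mul.
Proof. by move=> x; apply/val_inj; rewrite /= mul1r. Qed.
Lemma mt_mulDl : left_distributive mt_mul mt_add.
Proof. by move=> x y z; apply/val_inj; rewrite /= maxr_pMl ?mtval_ge0. Qed.
Lemma mt_mul0 : left_zero mt_zero mt_mul.
Proof. by move=> x; apply/val_inj; rewrite /= mul0r. Qed.
Lemma mt_one_neq0 : mt_one != mt_zero.
Proof. by rewrite -(inj_eq val_inj) /= oner_eq0. Qed.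

HB.instance Definition _ :=
  GRing.isNmodule.Build (maxtimes R) mt_addA mt_addC mt_add0.
HB.instance Definition _ := GRing.Nmodule_isComNzSemiRing.Build (maxtimes R)
  mt_mulA mt_mulC mt_mul1 mt_mulDl mt_mul0 mt_one_neq0.

Lemma mt_inv_subproof x : 0 <= (mtval x)^-1.
Proof. by rewrite invr_ge0 mtval_ge0. Qed.

(* By the convention 0^-1 = 0 of the library, mtinv 0 = 0. *)
Definition mtinv x : maxtimes R := MaxTimes (mt_inv_subproof x).

Definition mtroot (k : nat) x : maxtimes R :=
  MaxTimes (powR_ge0 (mtval x) k%:R^-1).

End MaxTimesStructure.

Section MaxTimesMatrices.
Variable R : realType.
Local Notation T := (maxtimes R).

Definition regular n (x : 'cV[T]_n) : Prop := forall i, x i 0 != 0.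

(* A^-; for a column vector x, mtconj x is the row vector x^-. *)
Definition mtconj m n (A : 'M[T]_(m, n)) : 'M[T]_(n, m) :=
  \matrix_(i, j) mtinv (A j i).

Definition rho n (A B : 'M[T]_n) : T :=
  \tr (mtconj B *m A) + \tr (mtconj A *m B).

Definition mt_eigenvalue n (A : 'M[T]_n) (l : T) : Prop :=
  exists2 x : 'cV[T]_n, x != 0 & A *m x = l *: x.

Definition is_spectral_radius n (A : 'M[T]_n) (l : T) : Prop :=
  mt_eigenvalue A l /\ forall l', mt_eigenvalue A l' -> l' <= l.

(* For n > 0 this is the unique l such that is_spectral_radius A l:
   see is_spectral_radiusP. *)
Definition spectral_radius n (A : 'M[T]_n) : T :=
  \sum_(1 <= k < n.+1) mtroot k (\tr (A ^+ k)).

(* Meaningful when \tr A, ..., \tr (A ^+ n) are all at most 1; for a matrix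
   divided by its spectral radius this is mxtrace_normalized_le1. *)
Definition kleene_star n (A : 'M[T]_n) : 'M[T]_n := \sum_(k < n) A ^+ k.

End MaxTimesMatrices.

Section MaxTimesTheory.
Variable R : realType.
Local Notation T := (maxtimes R).
Implicit Types x y z a b : T.

Lemma mt_leE x y : (x <= y) = (mtval x <= mtval y). Proof. by []. Qed.

Lemma mt_addE x y : x + y = Order.max x y.
Proof.
case: leP => h; apply/val_inj => /=; first exact/max_r.
by apply/max_l/ltW; move: h; rewrite !ltNge.
Qed.

Lemma mt_leD x y z : (x + y <= z) = (x <= z) && (y <= z).
Proof. by rewrite mt_addE ge_max. Qed.

Lemma mt_addxx x : x + x = x. Proof. by rewrite mt_addE maxxx. Qed.

Lemma mt_ge0 x : (0 : T) <= x. Proof. exact: mtval_ge0. Qed.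

Lemma mt_le0 x : (x <= 0) = (x == 0).
Proof. by rewrite eq_le mt_ge0 andbT. Qed.

Lemma mt_leM x y a b : x <= y -> a <= b -> x * a <= y * b.
Proof. by rewrite !mt_leE => *; apply: ler_pM => //; apply: mtval_ge0. Qed.

Lemma mt_leX k x y : x <= y -> x ^+ k <= y ^+ k.
Proof.
by move=> h; elim: k => [|k IH]; rewrite ?expr0 // !exprS mt_leM.
Qed.

Lemma mt_le_sum (I : finType) (F : I -> T) i : F i <= \sum_j F j.
Proof. by rewrite (bigD1 i) //= mt_addE le_max lexx. Qed.

Lemma mt_sum_le (I : Type) (r : seq I) (P : pred I) (F : I -> T) z :
  (forall i, P i -> F i <= z) -> \sum_(i <- r | P i) F i <= z.
Proof.
by move=> h; elim/big_ind: _ => [|a b ha hb|]; rewrite ?mt_ge0 // mt_leD ha.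
Qed.

Lemma mt_sum_attained (I : finType) (F : I -> T) :
  \sum_i F i != 0 -> exists i, \sum_i F i = F i.
Proof.
apply: (big_ind (fun s => s != 0 -> exists i, s = F i)) => [|a b ha hb|i _ _].
- by rewrite eqxx.
- by rewrite mt_addE; case: leP.
- by exists i.
Qed.

Lemma mt_mulVf x : x != 0 -> mtinv x * x = 1.
Proof.
rewrite -(inj_eq val_inj) /= => h; apply/val_inj; exact: mulVf.
Qed.

Lemma mt_mulI x a b : x != 0 -> x * a <= x * b -> a <= b.
Proof.
rewrite -(inj_eq val_inj) !mt_leE /= => h.
by rewrite ler_pM2l // lt_def h mtval_ge0.
Qed.

Lemma mtrootK k x : (0 < k)%N -> mtroot k x ^+ k = x.
Proof.
move=> k0; apply/val_inj.
have valX m y : mtval (y ^+ m) = mtval y ^+ m.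
  by elim: m => [|m IH]; rewrite ?expr0 // !exprS -IH.
rewrite /= valX /= -powR_mulrn ?powR_ge0 // -powRrM mulVf ?powRr1 ?mtval_ge0 //.
by rewrite pnatr_eq0 -lt0n.
Qed.

Lemma mt_leX_inv k x y : (0 < k)%N -> x ^+ k <= y ^+ k -> x <= y.
Proof.
have valX m z : mtval (z ^+ m) = mtval z ^+ m.
  by elim: m => [|m IH]; rewrite ?expr0 // !exprS -IH.
by move=> k0; rewrite !mt_leE !valX ler_pXn2r // nnegrE mtval_ge0.
Qed.

Fixpoint walk n (D : 'M[T]_n) (i : 'I_n) (p : seq 'I_n) : T :=
  if p is j :: p' then D i j * walk D j p' else 1.

Lemma walk_cat n (D : 'M[T]_n) i p q :
  walk D i (p ++ q) = walk D i p * walk D (last i p) q.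
Proof.
by elim: p i => [|j p IH] i /=; rewrite ?mul1r // IH mulrA.
Qed.

Lemma walk_le n (D : 'M[T]_n) i p : walk D i p <= (D ^+ size p) i (last i p).
Proof.
elim: p i => [|j p IH] i /=; first by rewrite expr0 mxE eqxx.
rewrite exprS mxE; apply: le_trans (mt_le_sum _ j).
exact: mt_leM.
Qed.

Lemma walk_attained n (D : 'M[T]_n) k i j : (D ^+ k) i j != 0 ->
  exists p, [/\ size p = k, last i p = j & walk D i p = (D ^+ k) i j].
Proof.
elim: k i => [|k IH] i.
  rewrite expr0 mxE; have [->|] := eqVneq i j; last by rewrite eqxx.
  by exists [::].
rewrite exprS mxE => nz; have [l el] := mt_sum_attained nz.
rewrite el in nz *.
have [|p [sp lp wp]] := IH l.
  by apply: contraNneq nz => ->; rewrite mulr0.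
by exists (l :: p); rewrite /= sp lp wp.
Qed.

Lemma not_uniq_cycle (I : eqType) (i : I) (p : seq I) : ~~ uniq (i :: p) ->
  exists p1 p2 p3, [/\ p = p1 ++ p2 ++ p3, (0 < size p2)%N &
                       last (last i p1) p2 = last i p1].
Proof.
elim: p i => [|j p IH] i //.
have [/path.splitP[p2 p3]|ni] := boolP (i \in j :: p).
  by exists [::], (rcons p2 i), p3; rewrite size_rcons last_rcons.
rewrite cons_uniq ni => /IH[p1 [p2 [p3 [-> s e]]]].
by exists (j :: p1), p2, p3.
Qed.

Lemma le_kleene_star n (D : 'M[T]_n) k i j : (k < n)%N ->
  (D ^+ k) i j <= kleene_star D i j.
Proof.
move=> kn; rewrite /kleene_star summxE.
exact: (mt_le_sum (fun k : 'I_n => (D ^+ k) i j) (Ordinal kn)).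
Qed.

Lemma cycle_cut n (D : 'M[T]_n) (r : T) i j :
  (forall k, (0 < k <= n)%N -> \tr (D ^+ k) <= r) ->
  (D ^+ n) i j <= r * kleene_star D i j.
Proof.
move=> tr_le; have [->|] := eqVneq ((D ^+ n) i j) 0; first exact: mt_ge0.
move=> /walk_attained[p [sp lp <-]].
have /not_uniq_cycle[p1 [p2 [p3 [ep s2 e2]]]] : ~~ uniq (i :: p).
  apply/negP => /card_uniqP /= e; have := max_card (mem (i :: p)).
  by rewrite e card_ord sp ltnn.
have sn : n = (size p1 + (size p2 + size p3))%N.
  by rewrite -[LHS]sp ep !size_cat.
have -> : walk D i p = walk D (last i p1) p2 * walk D i (p1 ++ p3).
  by rewrite ep !walk_cat e2 mulrCA.
apply: mt_leM.
  apply: le_trans (walk_le _ _ _) _; rewrite e2.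
  apply: le_trans (tr_le (size p2) _); last first.
    by rewrite s2 [leqRHS]sn addnCA leq_addr.
  exact: (mt_le_sum (fun k => (D ^+ size p2) k k)).
apply: le_trans (walk_le _ _ _) _.
have -> : last i (p1 ++ p3) = j by rewrite -lp ep !last_cat e2.
apply: le_kleene_star.
by rewrite size_cat [ltnRHS]sn ltn_add2l -[ltnLHS]add0n ltn_add2r.
Qed.

Lemma expmxZ n (a : T) (A : 'M[T]_n) k : (a *: A) ^+ k = a ^+ k *: A ^+ k.
Proof.
elim: k => [|k IH]; first by rewrite !expr0 scale1r.
by rewrite !exprS IH -[LHS]/(_ *m _) -scalemxAl -scalemxAr scalerA.
Qed.

Lemma mxtrace_exp_le n (A : 'M[T]_n) k : (0 < k <= n)%N ->
  \tr (A ^+ k) <= spectral_radius A ^+ k.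
Proof.
move=> /andP[k0 kn]; rewrite -{1}(mtrootK (\tr (A ^+ k)) k0).
apply: mt_leX; rewrite /spectral_radius.
rewrite (bigD1_seq k) ?iota_uniq ?mem_index_iota ?k0 //=.
by rewrite mt_addE le_max lexx.
Qed.

Lemma expmx_fixed n (D : 'M[T]_n) (v : 'cV[T]_n) k :
  D *m v = v -> D ^+ k *m v = v.
Proof.
move=> h; elim: k => [|k IH]; first by rewrite expr0 mul1mx.
by rewrite exprS -[_ * _]/(_ *m _) -mulmxA IH.
Qed.

Lemma mulmx_col m n p (A : 'M[T]_(m, n)) (B : 'M[T]_(n, p)) j :
  A *m col j B = col j (A *m B).
Proof. by rewrite !colE mulmxA. Qed.

Lemma sum_const_mx m n p (A : 'M[T]_(n, p)) : (0 < m)%N -> \sum_(k < m) A = A.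
Proof.
case: m => // m _; elim: m => [|m IH]; first by rewrite big_ord1.
rewrite big_ord_recr /= IH; apply/matrixP => i j.
by rewrite !mxE mt_addxx.
Qed.

Lemma mt_eigenvalue_le n (A : 'M[T]_n) l :
  mt_eigenvalue A l -> l <= spectral_radius A.
Proof.
move=> [v v0 Av]; rewrite leNgt; apply/negP => lt_l.
set s := spectral_radius A in lt_l.
have l0 : l != 0 by rewrite -mt_le0 -ltNge (le_lt_trans (mt_ge0 s)).
set D := mtinv l *: A; set r := mtinv l * s.
have Dv : D *m v = v by rewrite -scalemxAl Av scalerA mt_mulVf ?scale1r.
have r_lt1 : r < 1.
  rewrite ltNge; apply/negP => h; move: lt_l; rewrite ltNge => /negP; apply.
  have := mt_leM (lexx l) h; rewrite /r mulrA [l * mtinv l]mulrC mt_mulVf //.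
  by rewrite mul1r mulr1.
have trD k : (0 < k <= n)%N -> \tr (D ^+ k) <= r.
  move=> kn; rewrite expmxZ linearZ /=.
  apply: (@le_trans _ _ (r ^+ k)).
    by rewrite exprMn mt_leM ?mxtrace_exp_le.
  case: k kn => // k _; rewrite exprS -[leRHS]mulr1 mt_leM //.
  by rewrite -(expr1n _ k) mt_leX // ltW.
have [i0 vi0] : exists i, v i 0 != 0.
  apply/existsP; rewrite -[[exists _, _]]negbK negb_exists.
  apply: contra v0 => /forallP h; apply/eqP/colP => i.
  by rewrite mxE; apply/eqP; rewrite -[_ == _]negbK.
have n0 : (0 < n)%N by apply: leq_ltn_trans (ltn_ord i0).
have starv : kleene_star D *m v = v.
  rewrite mulmx_suml -[RHS](sum_const_mx v n0).
  by apply: eq_bigr => k _; rewrite expmx_fixed.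
suff : v i0 0 <= r * v i0 0.
  move=> h; move: r_lt1; rewrite ltNge => /negP; apply.
  by apply: (mt_mulI vi0); rewrite mulr1 mulrC.
rewrite -{1}(expmx_fixed n Dv) -{2}starv !mxE mulr_sumr.
apply: mt_sum_le => j _.
apply: le_trans (mt_le_sum _ j); rewrite mulrA.
by rewrite mt_leM // cycle_cut.
Qed.

Lemma mt_eigenvalue_spectral_radius n (A : 'M[T]_n) :
  (0 < n)%N -> mt_eigenvalue A (spectral_radius A).
Proof.
move=> n0; set s := spectral_radius A.
have [s0|s0] := eqVneq s 0.
  have An0 : exists k, A ^+ k == 0.
    exists n; apply/eqP/matrixP => i j; rewrite mxE; apply/eqP.
    rewrite -mt_le0 -(mul0r (kleene_star A i j)).
    apply: cycle_cut => k kn; have := mxtrace_exp_le A kn.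
    by case: k kn => // k _; rewrite -/s s0 [0 ^+ _]exprS mul0r.
  case: (ex_minnP An0) => -[|k] /eqP Ak min.
    move/matrixP/(_ (Ordinal n0) (Ordinal n0))/eqP: Ak.
    by rewrite expr0 !mxE eqxx oner_eq0.
  have [j vj] : exists j, col j (A ^+ k) != 0.
    apply/existsP; rewrite -[[exists _, _]]negbK negb_exists.
    apply/negP => /forallP h; suff /min : A ^+ k == 0 by rewrite ltnn.
    apply/eqP/matrixP => i j.
    have /eqP/colP/(_ i) : col j (A ^+ k) == 0 by rewrite -[_ == _]negbK.
    by rewrite !mxE.
  exists (col j (A ^+ k)) => //.
  rewrite s0 scale0r mulmx_col -[_ *m _]exprS Ak.
  by apply/colP => i; rewrite !mxE.
have Es : s = \sum_(k < n) mtroot k.+1 (\tr (A ^+ k.+1)).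
  by rewrite /s /spectral_radius big_add1 /= big_mkord.
have [k sk] : exists k : 'I_n, s ^+ k.+1 = \tr (A ^+ k.+1).
  have := s0; rewrite {1}Es => /mt_sum_attained[k ek].
  by exists k; rewrite Es ek mtrootK.
have [i si] : exists i, s ^+ k.+1 = (A ^+ k.+1) i i.
  rewrite sk; apply: mt_sum_attained; rewrite -[\sum_i _]/(\tr (A ^+ k.+1)) -sk.
  apply: contraNneq s0 => e; rewrite -mt_le0.
  by apply: (@mt_leX_inv k.+1) => //; rewrite e mt_ge0.
set C := mtinv s *: A.
have CX m : mtinv s ^+ m * s ^+ m = 1.
  by rewrite -exprMn mt_mulVf // expr1n.
have AC : A = s *: C by rewrite scalerA mulrC mt_mulVf ?scale1r.
have Cii : (C ^+ k.+1) i i = 1 by rewrite expmxZ mxE -si CX.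
have starC j : (C *m kleene_star C) j i = \sum_(m < n) (C ^+ m.+1) j i.
  rewrite mulmx_sumr summxE; apply: eq_bigr => m _.
  by rewrite exprS.
have Cle m j : (m < n)%N -> (C ^+ m.+1) j i <= kleene_star C j i.
  rewrite leq_eqVlt => /predU1P[->|]; last exact: le_kleene_star.
  rewrite -[leRHS]mul1r; apply: cycle_cut => l ln.
  rewrite expmxZ linearZ /= -(CX l); apply: mt_leM => //.
  exact: mxtrace_exp_le.
have Cstar j : (C *m kleene_star C) j i = kleene_star C j i.
  apply/eqP; rewrite eq_le starC mt_sum_le //=; last first.
    by move=> m _; apply: Cle.
  rewrite {1}/kleene_star summxE; apply: mt_sum_le => -[[|m] mn] _.
    rewrite expr0 mxE; have [->|_] := eqVneq j i; last exact: mt_ge0.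
    by rewrite -Cii (mt_le_sum (fun m : 'I_n => (C ^+ m.+1) i i) k).
  exact: (mt_le_sum (fun m : 'I_n => (C ^+ m.+1) j i) (Ordinal (ltnW mn))).
exists (col i (kleene_star C)).
  apply/negP => /eqP/colP/(_ i); rewrite !mxE => e.
  have := le_kleene_star C i i n0; rewrite e mt_le0 expr0 mxE eqxx.
  by rewrite oner_eq0.
rewrite {1}AC -scalemxAl mulmx_col; congr (_ *: _).
by apply/colP => j; rewrite mxE Cstar mxE.
Qed.

Lemma is_spectral_radiusP n (A : 'M[T]_n) l :
  (0 < n)%N -> is_spectral_radius A l <-> l = spectral_radius A.
Proof.
move=> n0; have eA := mt_eigenvalue_spectral_radius A n0.
split=> [[el lmax]|->]; last by split=> // l'; apply: mt_eigenvalue_le.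
by apply/eqP; rewrite eq_le lmax // mt_eigenvalue_le.
Qed.

Lemma mxtrace_normalized_le1 n (A : 'M[T]_n) l k :
  is_spectral_radius A l -> l != 0 -> (0 < k <= n)%N ->
  \tr ((mtinv l *: A) ^+ k) <= 1.
Proof.
move=> lA l0 kn; have n0 : (0 < n)%N by case/andP: kn; apply: leq_trans.
rewrite expmxZ linearZ /= -(expr1n _ k) -(mt_mulVf l0) exprMn.
apply: mt_leM => //; have -> : l = spectral_radius A.
  exact/is_spectral_radiusP.
exact: mxtrace_exp_le.
Qed.

End MaxTimesTheory.

(* Main.v *)
(* For regular x one has rho(A, x x^-) = max_(i, j) b_ij x_j / x_i, so that
   rho(A, x x^-) <= l means that x is a subeigenvector: B x <= l x.
   Comparing x with an eigenvector of B for mu gives mu <= l; the regular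
   subeigenvectors for l = mu are the fixed points of B_mu^*, which are the
   vectors B_mu^* u because B_mu B_mu^* <= B_mu^*. *)
Require Import Defs.
From mathcomp Require Import all_boot all_order all_algebra.
From mathcomp Require Import reals.

Set Implicit Arguments.
Unset Strict Implicit.
Unset Printing Implicit Defensive.

Import Order.TTheory GRing.Theory Num.Theory.
Local Open Scope ring_scope.

Section Subeigenvectors.
Variable R : realType.
Local Notation T := (maxtimes R).

Lemma mt_sum_leP (I : finType) (F : I -> T) z :
  \sum_i F i <= z <-> forall i, F i <= z.
Proof.
split=> [h i|h]; first exact: le_trans (mt_le_sum F i) h.
by apply: mt_sum_le => i _; apply: h.
Qed.

Lemma mt_ler_pdivrMl (a b l : T) : a != 0 -> mtinv a * b <= l <-> b <= a * l.
Proof.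
move=> a0; split=> h.
  by rewrite -[b]mul1r -(mt_mulVf a0) [mtinv a * a]mulrC -mulrA mt_leM.
by apply: (mt_mulI a0); rewrite mulrA [a * _]mulrC mt_mulVf ?mul1r.
Qed.

Lemma mtinvM (a b : T) : mtinv (a * b) = mtinv a * mtinv b.
Proof. by apply/val_inj; rewrite /= invfM. Qed.

Lemma mtinvK : involutive (@mtinv R).
Proof. by move=> a; apply/val_inj; rewrite /= invrK. Qed.

Definition subeigenvector n (B : 'M[T]_n) (l : T) (x : 'cV[T]_n) : Prop :=
  forall i, (B *m x) i 0 <= l * x i 0.

Lemma subeigenvectorP n (B : 'M[T]_n) l (x : 'cV[T]_n) :
  subeigenvector B l x <-> forall i j, B i j * x j 0 <= l * x i 0.
Proof.
split=> [h i j|h i]; last by rewrite mxE; apply/mt_sum_leP.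
by move: (h i); rewrite mxE => /mt_sum_leP.
Qed.

Lemma rank1_mtconjE n (x : 'cV[T]_n) i j :
  (x *m mtconj x) i j = x i 0 * mtinv (x j 0).
Proof. by rewrite mxE big_ord1 mxE. Qed.

(** The first trace is the maximum of the [A i j * x j 0 / x i 0], the second the same maximum for
    [mtconj A]; together they bound the entries of the sum of both matrices. *)
Lemma rho_rank1_le n (A : 'M[T]_n) l (x : 'cV[T]_n) : regular x ->
  rho A (x *m mtconj x) <= l <-> subeigenvector (A + mtconj A) l x.
Proof.
move=> x_reg; rewrite /rho mt_leD.
have entryP i j a : x i 0 != 0 ->
    a * (x j 0 * mtinv (x i 0)) <= l <-> a * x j 0 <= l * x i 0.
  by move=> xi; rewrite mulrA mulrC [l * _]mulrC; apply: mt_ler_pdivrMl.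
have conjE i j : mtconj (x *m mtconj x) i j * A j i =
    A j i * (x i 0 * mtinv (x j 0)).
  by rewrite [mtconj _ i j]mxE rank1_mtconjE mtinvM mtinvK mulrC [mtinv _ * _]mulrC.
split=> [/andP[/mt_sum_leP h1 /mt_sum_leP h2]|/subeigenvectorP h].
  apply/subeigenvectorP => i j.
  rewrite mxE mulrDl mt_leD; apply/andP; split; apply/entryP => //.
    (* The conjugate transposes, so the bound on [A i j] is read off diagonal entry [j] of the first
       product. *)
    by move: (h1 j); rewrite mxE => /mt_sum_leP/(_ i); rewrite conjE.
  by move: (h2 i); rewrite mxE => /mt_sum_leP/(_ j); rewrite rank1_mtconjE.
apply/andP; split; apply/mt_sum_leP => i; rewrite mxE; apply/mt_sum_leP => j.
  rewrite conjE; apply/entryP => //.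
  by move: (h j i); rewrite mxE mulrDl mt_leD => /andP[].
rewrite rank1_mtconjE; apply/entryP => //.
by move: (h i j); rewrite mxE mulrDl mt_leD => /andP[].
Qed.

(** Scale [x] until it just dominates the eigenvector [v]. At an index [i] where [v] and [c x]
    touch, [mu v_i = (B v)_i <= c (B x)_i <= c l x_i = l v_i], and [v_i] cancels. *)
Lemma mt_eigenvalue_le_subeigenvector n (B : 'M[T]_n) mu l (x : 'cV[T]_n) :
  mt_eigenvalue B mu -> regular x -> subeigenvector B l x -> mu <= l.
Proof.
move=> [v v0 Bv] x_reg /subeigenvectorP h.
(* The least c with v <= c x. *)
pose c := \sum_i mtinv (x i 0) * v i 0.
have vle j : v j 0 <= c * x j 0.
  rewrite mulrC; apply/(mt_ler_pdivrMl _ _ (x_reg j)).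
  exact: (mt_le_sum (fun i => mtinv (x i 0) * v i 0)).
have c0 : c != 0.
  apply: contraNneq v0 => c0; apply/eqP/colP => j; rewrite mxE; apply/eqP.
  by rewrite -mt_le0; move: (vle j); rewrite c0 mul0r.
have [i ci] := mt_sum_attained c0.
have vi : v i 0 = c * x i 0.
  by rewrite [c]ci mulrC mulrA [x i 0 * _]mulrC mt_mulVf ?mul1r.
have vi0 : v i 0 != 0 by apply: contraNneq c0 => e; rewrite [c]ci e mulr0.
apply: (mt_mulI vi0); rewrite mulrC.
have -> : mu * v i 0 = (B *m v) i 0 by rewrite Bv mxE.
rewrite mxE; apply: mt_sum_le => j _.
apply: le_trans (mt_leM (lexx (B i j)) (vle j)) _.
by rewrite mulrCA vi -mulrA [x i 0 * l]mulrC mt_leM.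
Qed.

Lemma subeigenvector_normalized n (B : 'M[T]_n) l (x : 'cV[T]_n) : l != 0 ->
  subeigenvector (mtinv l *: B) 1 x <-> subeigenvector B l x.
Proof.
move=> l0; rewrite /subeigenvector -scalemxAl; split=> h i; move: (h i);
  rewrite [fun_of_matrix (_ *: _) _ _]mxE mul1r => hi; exact/(mt_ler_pdivrMl _ _ l0).
Qed.

Lemma le_kleene_star_mul n (D : 'M[T]_n) (x : 'cV[T]_n) i :
  x i 0 <= (kleene_star D *m x) i 0.
Proof.
rewrite mxE; apply: le_trans (mt_le_sum _ i); rewrite -[leLHS]mul1r mt_leM //.
(* The term [D ^+ 0] puts 1 on the diagonal of the star; the index [i] itself shows that [n] is
   positive. *)
have := le_kleene_star D i i (leq_ltn_trans (leq0n i) (ltn_ord i)).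
by rewrite expr0 mxE eqxx.
Qed.

(** Iterating [D x <= x] gives [D^k x <= x] for every term of the star; the identity term gives the
    other inequality. *)
Lemma kleene_star_fixed n (D : 'M[T]_n) (x : 'cV[T]_n) :
  subeigenvector D 1 x -> kleene_star D *m x = x.
Proof.
move=> /subeigenvectorP h; apply/colP => i.
apply/eqP; rewrite eq_le le_kleene_star_mul andbT.
rewrite mulmx_suml summxE; apply: mt_sum_le => -[k _] _ /=.
elim: k i => [|k IH] i; first by rewrite expr0 mul1mx.
rewrite exprS -[_ * _]/(_ *m _) -mulmxA mxE; apply: mt_sum_le => j _.
apply: le_trans (mt_leM (lexx _) (IH j)) _.
by have := h i j; rewrite mul1r.
Qed.

(** The product of [D] with its star is the sum of [D^1, ..., D^n], and each of these powers lies
    below the star. *)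
Lemma subeigenvector_kleene_star n (D : 'M[T]_n) (u : 'cV[T]_n) :
  (forall k, (0 < k <= n)%N -> \tr (D ^+ k) <= 1) ->
  subeigenvector D 1 (kleene_star D *m u).
Proof.
move=> trD i; rewrite mul1r mulmxA !mxE; apply: mt_sum_le => j _.
apply: le_trans (mt_le_sum _ j); apply: mt_leM => //.
rewrite mulmx_sumr summxE; apply: mt_sum_le => -[k kn] _ /=.
rewrite -[_ *m _]exprS; move: kn; rewrite leq_eqVlt => /predU1P[->|].
  (* Only [D^n] is not a term of the star: a walk of length [n] contains a cycle, of weight at most
     1, which can be cut out. *)
  by rewrite -[leRHS]mul1r; apply: cycle_cut.
exact: le_kleene_star.
Qed.

Lemma mt_eigenvalue_size_gt0 n (B : 'M[T]_n) l : mt_eigenvalue B l -> (0 < n)%N.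
Proof. by case: n B => // B [v]; rewrite flatmx0 eqxx. Qed.

(** Loops are cycles of length 1, so [mu] bounds every diagonal entry. *)
Lemma spectral_radius_neq0 n (B : 'M[T]_n) mu i :
  is_spectral_radius B mu -> B i i != 0 -> mu != 0.
Proof.
move=> Bmu; apply: contraNneq => mu0.
have n0 : (0 < n)%N by apply: leq_ltn_trans (ltn_ord i).
rewrite -mt_le0 -mu0; apply: le_trans (mt_le_sum (fun k => B k k) i) _.
have /is_spectral_radiusP-> // := Bmu.
by have := mxtrace_exp_le B (k := 1); rewrite !expr1 n0; apply.
Qed.

End Subeigenvectors.

Unset Implicit Arguments.

Theorem theorem3 (R : realType) (n : nat) (A : 'M[maxtimes R]_n) :
  let B : 'M[maxtimes R]_n := A + mtconj A in
  (forall i j, B i j != 0) ->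
  forall mu : maxtimes R, is_spectral_radius B mu ->
  let Bmu : 'M[maxtimes R]_n := mtinv mu *: B in
  let f (x : 'cV[maxtimes R]_n) : maxtimes R := rho A (x *m mtconj x) in
  ((exists x, regular x /\ f x = mu) /\ (forall x, regular x -> mu <= f x)) /\
  (forall x : 'cV[maxtimes R]_n,
     (regular x /\ (forall y, regular y -> f x <= f y)) <->
     (exists u : 'cV[maxtimes R]_n, regular u /\ x = kleene_star Bmu *m u)).
Proof.
move=> B B0 mu Bmu_sr Bmu f.
have n0 := mt_eigenvalue_size_gt0 Bmu_sr.1.
have mu0 : mu != 0 by apply: spectral_radius_neq0 Bmu_sr (B0 (Ordinal n0) _).
have f_le l x : regular x -> f x <= l <-> subeigenvector B l x.
  exact: rho_rank1_le.
have mu_le x : regular x -> mu <= f x.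
  move=> x_reg; apply: (mt_eigenvalue_le_subeigenvector Bmu_sr.1 x_reg).
  exact/f_le.
have star_reg u : regular u -> regular (kleene_star Bmu *m u).
  move=> u_reg i; apply: contraNneq (u_reg i) => e.
  by rewrite -mt_le0 -e le_kleene_star_mul.
have star_min u : regular u -> f (kleene_star Bmu *m u) = mu.
  move=> u_reg; apply/eqP; rewrite eq_le mu_le ?andbT; last exact: star_reg.
  apply/f_le; first exact: star_reg.
  apply/subeigenvector_normalized => //; apply: subeigenvector_kleene_star.
  by move=> k kn; apply: mxtrace_normalized_le1.
(* A concrete parameter [u], to exhibit one vector at which the value [mu] is attained. *)
have one_reg : regular (const_mx 1 : 'cV[maxtimes R]_n).
  by move=> i; rewrite mxE oner_neq0.
split; first split=> //.
  by exists (kleene_star Bmu *m const_mx 1); split; [exact: star_reg|exact: star_min].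
move=> x; split=> [[x_reg x_min]|[u [u_reg ->]]]; last first.
  by split=> [|y y_reg]; [exact: star_reg|rewrite star_min ?mu_le].
(* A minimizer is its own parameter: its value is at most that of the vector built from
   [const_mx 1], namely [mu], so it is a subeigenvector and the star fixes it. *)
exists x; split=> //; apply/esym/kleene_star_fixed.
apply/subeigenvector_normalized => //; apply/f_le => //.
by rewrite -(star_min _ one_reg); apply/x_min/star_reg.
Qed.
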